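(* Let $k$ be a field of characteristic $p>0$, $G$ a finite group, $1\neq H\in\mathrm{Syl}_p(G)$ a nontrivial Sylow $p$-subgroup, and $V$ a finitely generated (right) $kG$-module with symmetric algebra $S(V)=\mathrm{Sym}(V)$. Then the following hold: (1) Let $v\in V^G$ with $v^{p^N}=\mathrm{tr}_G(f)$ or $v^{p^N}=\mathrm{tr}_H(f)$ for some $f\in S(V)$ and $N\in\mathbb N$. Then $S(V)/(v-1)\in\mathfrak{Ts}_G$ is s-projective. (2) If $B\in\mathfrak{Ts}_G$ (and $v\in V^G$), then $B\otimes_k\big(S(V)/(v-1)\big)\cong B\otimes_k S(V/kv)$ as $B$-algebras. (3) If $B\in\mathfrak{Ts}_G$ is s-projective in $\mathfrak{Ts}_G$, then so are $B\otimes_k S(V)$ and (for $v\in V^G$) $B\otimes_k\big(S(V)/(v-1)\big)$.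
   Context: $\mathfrak{Ts}_G$ is the category of finitely generated commutative $k$-algebras $A$ on which $G$ acts by $k$-algebra automorphisms such that the trace map $\mathrm{tr}_G: A\to A^G$, $a\mapsto\sum_{g\in G} ag$, is surjective onto the ring of invariants $A^G$; morphisms are $G$-equivariant $k$-algebra homomorphisms. For the subgroup $H\le G$, $\mathrm{tr}_H(a)=\sum_{h\in H}ah$. $V^G$ is the space of $G$-fixed points in $V$. Symmetric algebras of $kG$-modules carry the induced $G$-action by graded algebra automorphisms, $(v-1)$ is the ($G$-stable) ideal of $S(V)$ generated by $v-1$, and tensor products carry the diagonal $G$-action. An object $B\in\mathfrak{Ts}_G$ is s-projective if for every surjective morphism $A\to A'$ in $\mathfrak{Ts}_G$ the induced map $\mathfrak{Ts}_G(B,A)\to\mathfrak{Ts}_G(B,A')$ of morphism sets is surjective.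
   Formalization: The vector v is assumed nonzero wherever S(V)/(v-1) occurs: for v = 0 (allowed in the text, with f = 0) this is the zero algebra, which is not s-projective, and the isomorphism in (2) fails for B ≠ 0. *)

(* Defs.v *)
From HB Require Import structures.
From mathcomp Require Import all_boot all_order all_algebra all_fingroup.
From mathcomp Require Import all_solvable all_character.
From mathcomp Require Import mpoly boolp.

Set Implicit Arguments.
Unset Strict Implicit.
Unset Printing Implicit Defensive.

Import GRing.Theory.

Local Open Scope ring_scope.

Section GAlgebra.
Variables (k : fieldType) (G : finGroupType).

(* The library's comAlgType excludes the zero algebra, so a commutative       *)
(* k-algebra is a comPzRingType together with its structure morphism from k.  *)
(* As in the library, act_morph to x means to x (g * h) = to (to x g) h.      *)
Record galgebra := GAlgebra {
  gcarrier :> comPzRingType;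
  gscal : {rmorphism k -> gcarrier};
  gact : gcarrier -> G -> gcarrier;
  gact_id : gact^~ 1%g =1 id;
  gact_comp : forall x, act_morph gact x;
  gact_zmod : forall g, zmod_morphism (gact^~ g);
  gact_monoid : forall g, monoid_morphism (gact^~ g);
  gact_scal : forall c g, gact (gscal c) g = gscal c
}.

Arguments gact : clear implicits.
Arguments gact_id : clear implicits.
Arguments gact_comp : clear implicits.
Arguments gact_zmod : clear implicits.
Arguments gact_monoid : clear implicits.
Arguments gact_scal : clear implicits.

Definition ghom (A B : galgebra) (f : A -> B) : Prop :=
  [/\ zmod_morphism f, monoid_morphism f,
      forall c, f (gscal A c) = gscal B c
    & forall a g, f (gact A a g) = gact B (f a) g].

Definition surj (S T : Type) (f : S -> T) : Prop := forall y, exists x, f x = y.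

Lemma gact0 (A : galgebra) g : gact A 0 g = 0.
Proof. by have /= := gact_zmod A g 0 0; rewrite !subrr. Qed.
Lemma gactN (A : galgebra) x g : gact A (- x) g = - gact A x g.
Proof. by have /= := gact_zmod A g 0 x; rewrite gact0 !sub0r. Qed.
Lemma gactD (A : galgebra) x y g : gact A (x + y) g = gact A x g + gact A y g.
Proof. by have /= := gact_zmod A g x (- y); rewrite gactN !opprK. Qed.
Lemma gactM (A : galgebra) x y g : gact A (x * y) g = gact A x g * gact A y g.
Proof. exact: (gact_monoid A g).2. Qed.
Lemma gact1 (A : galgebra) g : gact A 1 g = 1.
Proof. exact: (gact_monoid A g).1. Qed.

Definition subalgebra (A : galgebra) (P : A -> Prop) : Prop :=
  [/\ forall c, P (gscal A c),
      forall a b, P a -> P b -> P (a + b)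
    & forall a b, P a -> P b -> P (a * b)].

Definition fin_gen (A : galgebra) : Prop :=
  exists s : seq A, forall P : A -> Prop,
    subalgebra P -> (forall a, a \in s -> P a) -> forall a, P a.

Definition ginv (A : galgebra) (a : A) : Prop := forall g, gact A a g = a.

Definition gtr (H : {set G}) (A : galgebra) (a : A) : A :=
  \sum_(h in H) gact A a h.

Definition in_Ts (A : galgebra) : Prop :=
  fin_gen A /\ forall a : A, ginv a -> exists b : A, gtr [set: G] b = a.

Definition s_projective (B : galgebra) : Prop :=
  in_Ts B /\
  forall (A A' : galgebra) (q : A -> A') (f : B -> A'),
    in_Ts A -> in_Ts A' -> ghom q -> surj q -> ghom f ->
    exists f' : B -> A, ghom f' /\ forall b, q (f' b) = f b.

End GAlgebra.

Arguments gtr {k G} H {A} a.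
Arguments gact {k G}.
Arguments gact_id {k G}.
Arguments gact_comp {k G}.
Arguments gact_zmod {k G}.
Arguments gact_monoid {k G}.
Arguments gact_scal {k G}.

Section Quotient.
Variables (k : fieldType) (G : finGroupType) (A : galgebra k G) (a : A).

Definition quot_eqv : rel A := fun x y => `[< exists c : A, x - y = c * a >].

Lemma quot_eqv_equiv : equiv_class_of quot_eqv.
Proof.
split=> [x|x y|y x z].
- by apply/asboolP; exists 0; rewrite subrr mul0r.
- by apply/asboolP/asboolP => -[c e]; exists (- c); rewrite mulNr -e opprB.
- move=> /asboolP[c e] /asboolP[d f]; apply/asboolP; exists (c + d).
  by rewrite mulrDl -e -f addrA subrK.
Qed.
Canonical quot_eqv_rel := EquivRelPack quot_eqv_equiv.
Canonical quot_eqv_encModRel := defaultEncModRel quot_eqv.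

Definition quot : Type := {eq_quot quot_eqv}%qT.
HB.instance Definition _ := Choice.on quot.

Definition qpi (x : A) : quot := (\pi_({eq_quot quot_eqv}%qT) x)%qT.
Definition qrepr (x : quot) : A := generic_quotient.repr (x : {eq_quot quot_eqv}%qT).

Lemma qreprK x : qpi (qrepr x) = x. Proof. exact: reprK. Qed.

Lemma qpiP x y : qpi x = qpi y <-> exists c, x - y = c * a.
Proof.
have e : (x == y %[mod {eq_quot quot_eqv}])%qT = quot_eqv x y := eqmodE _ x y.
split=> [h|h]; last by apply: (elimT eqP); rewrite e; apply/asboolP.
have : (x == y %[mod {eq_quot quot_eqv}])%qT by apply: (introT eqP).
by rewrite e => /asboolP.
Qed.

Definition qadd (x y : quot) := qpi (qrepr x + qrepr y).
Definition qopp (x : quot) := qpi (- qrepr x).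
Definition qmul (x y : quot) := qpi (qrepr x * qrepr y).

Lemma qpiD x y : qpi (x + y) = qadd (qpi x) (qpi y).
Proof.
have [c e] : exists c, x - qrepr (qpi x) = c * a by apply/qpiP; rewrite qreprK.
have [d f] : exists c, y - qrepr (qpi y) = c * a by apply/qpiP; rewrite qreprK.
by apply/qpiP; exists (c + d); rewrite mulrDl -e -f opprD addrACA.
Qed.

Lemma qpiN x : qpi (- x) = qopp (qpi x).
Proof.
have [c e] : exists c, x - qrepr (qpi x) = c * a by apply/qpiP; rewrite qreprK.
by apply/qpiP; exists (- c); rewrite mulNr -e opprB opprK addrC.
Qed.

Lemma qpiM x y : qpi (x * y) = qmul (qpi x) (qpi y).
Proof.
have [c e] : exists c, x - qrepr (qpi x) = c * a by apply/qpiP; rewrite qreprK.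
have [d f] : exists c, y - qrepr (qpi y) = c * a by apply/qpiP; rewrite qreprK.
apply/qpiP; exists (c * y + qrepr (qpi x) * d).
rewrite mulrDl mulrAC -e -mulrA -f mulrBl mulrBr addrA subrK //.
Qed.

Lemma qpiW (P : quot -> Prop) : (forall x, P (qpi x)) -> forall x, P x.
Proof. by move=> h x; rewrite -(qreprK x). Qed.

Lemma qaddA : associative qadd.
Proof. by do 3![elim/qpiW=> ?]; rewrite -!qpiD addrA. Qed.
Lemma qaddC : commutative qadd.
Proof. by do 2![elim/qpiW=> ?]; rewrite -!qpiD addrC. Qed.
Lemma qadd0 : left_id (qpi 0) qadd.
Proof. by elim/qpiW=> ?; rewrite -!qpiD add0r. Qed.
Lemma qaddN : left_inverse (qpi 0) qopp qadd.
Proof. by elim/qpiW=> ?; rewrite -qpiN -!qpiD addNr. Qed.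
HB.instance Definition _ := GRing.isZmodule.Build quot qaddA qaddC qadd0 qaddN.

Lemma qmulA : associative qmul.
Proof. by do 3![elim/qpiW=> ?]; rewrite -!qpiM mulrA. Qed.
Lemma qmulC : commutative qmul.
Proof. by do 2![elim/qpiW=> ?]; rewrite -!qpiM mulrC. Qed.
Lemma qmul1 : left_id (qpi 1) qmul.
Proof. by elim/qpiW=> ?; rewrite -!qpiM mul1r. Qed.
Lemma qmulDl : left_distributive qmul +%R.
Proof.
by do 3![elim/qpiW=> ?]; rewrite /GRing.add /= -!(qpiM, qpiD) mulrDl.
Qed.
HB.instance Definition _ :=
  GRing.Zmodule_isComPzRing.Build quot qmulA qmulC qmul1 qmulDl.

Lemma qpi_zmod : zmod_morphism qpi.
Proof. by move=> x y; rewrite qpiD qpiN. Qed.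
Lemma qpi_monoid : monoid_morphism qpi.
Proof. by split=> // x y; rewrite qpiM. Qed.
HB.instance Definition _ := GRing.isZmodMorphism.Build A quot qpi qpi_zmod.
HB.instance Definition _ := GRing.isMonoidMorphism.Build A quot qpi qpi_monoid.

Hypothesis a_inv : ginv a.

Definition qact (x : quot) (g : G) : quot := qpi (gact A (qrepr x) g).

Lemma qactE x g : qact (qpi x) g = qpi (gact A x g).
Proof.
have [c e] : exists c, qrepr (qpi x) - x = c * a by apply/qpiP; rewrite qreprK.
apply/qpiP; exists (gact A c g).
by rewrite -[X in _ * X](a_inv g) -gactM -e gactD gactN.
Qed.

Lemma qact1 : qact^~ 1%g =1 id.
Proof. by elim/qpiW=> x; rewrite qactE gact_id. Qed.
Lemma qactM x : act_morph qact x.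
Proof.
move=> g h; elim/qpiW: x => x; rewrite !qactE; congr qpi; exact: gact_comp.
Qed.

Lemma qact_zmod g : zmod_morphism (qact^~ g).
Proof.
do 2![elim/qpiW=> ?] => /=.
by rewrite -rmorphB !qactE gact_zmod rmorphB.
Qed.
Lemma qact_monoid g : monoid_morphism (qact^~ g).
Proof.
split=> /= [|]; first by rewrite -(rmorph1 qpi) qactE (gact_monoid A g).1.
by do 2![elim/qpiW=> ?]; rewrite -rmorphM !qactE (gact_monoid A g).2 rmorphM.
Qed.
Lemma qact_scal c g :
  qact ((qpi \o gscal A) c) g = (qpi \o gscal A) c.
Proof. by rewrite /= qactE gact_scal. Qed.

(* The quotient of A by the ideal generated by the invariant element a.       *)
Definition gquot : galgebra k G :=
  @GAlgebra k G quot (qpi \o gscal A)%FUN qact qact1 qactM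
    qact_zmod qact_monoid qact_scal.

End Quotient.

Section Tensor.
Variables (k : fieldType) (G : finGroupType) (B C : galgebra k G).

(* A finite sequence of pairs (b, c) stands for the sum of the b (x) c.       *)
Inductive tens_eq : seq (B * C) -> seq (B * C) -> Prop :=
| TensRefl s : tens_eq s s
| TensSym s t : tens_eq s t -> tens_eq t s
| TensTrans s t u : tens_eq s t -> tens_eq t u -> tens_eq s u
| TensCat s s' t t' : tens_eq s s' -> tens_eq t t' -> tens_eq (s ++ t) (s' ++ t')
| TensCatC s t : tens_eq (s ++ t) (t ++ s)
| Tens0 c : tens_eq [:: (0, c)] [::]
| TensDl b b' c : tens_eq [:: (b + b', c)] [:: (b, c); (b', c)]
| TensDr b c c' : tens_eq [:: (b, c + c')] [:: (b, c); (b, c')]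
| TensZ x b c : tens_eq [:: (gscal B x * b, c)] [:: (b, gscal C x * c)].

Definition tens_eqv : rel (seq (B * C)) := fun s t => `[< tens_eq s t >].

Lemma tens_eqv_equiv : equiv_class_of tens_eqv.
Proof.
split=> [x|x y|y x z].
- by apply/asboolP; constructor.
- by apply/asboolP/asboolP; apply: TensSym.
- by move=> /asboolP h /asboolP h'; apply/asboolP; apply: TensTrans h h'.
Qed.
Canonical tens_eqv_rel := EquivRelPack tens_eqv_equiv.
Canonical tens_eqv_encModRel := defaultEncModRel tens_eqv.

Definition tens : Type := {eq_quot tens_eqv}%qT.
HB.instance Definition _ := Choice.on tens.

Definition tpi (s : seq (B * C)) : tens := (\pi_({eq_quot tens_eqv}%qT) s)%qT.
Definition trepr (x : tens) : seq (B * C) := generic_quotient.repr (x : {eq_quot tens_eqv}%qT).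

Definition pure (b : B) (c : C) : tens := tpi [:: (b, c)].

Lemma treprK x : tpi (trepr x) = x. Proof. exact: reprK. Qed.

Lemma tpiP s t : tpi s = tpi t <-> tens_eq s t.
Proof.
have e : (s == t %[mod {eq_quot tens_eqv}])%qT = tens_eqv s t := eqmodE _ s t.
split=> [h|h]; last by apply: (elimT eqP); rewrite e; apply/asboolP.
have : (s == t %[mod {eq_quot tens_eqv}])%qT by apply: (introT eqP).
by rewrite e => /asboolP.
Qed.

Lemma tpiW (P : tens -> Prop) : (forall s, P (tpi s)) -> forall x, P x.
Proof. by move=> h x; rewrite -(treprK x). Qed.

Lemma tens_perm s t : perm_eq s t -> tens_eq s t.
Proof.
move=> h; apply: (catCA_perm_ind _ h) (TensRefl s) => {h} s1 s2 s3 h.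
apply: TensTrans h _; rewrite !catA.
by apply: TensCat; constructor.
Qed.

Definition topp_seq (s : seq (B * C)) := [seq (- x.1, x.2) | x <- s].
Definition tmul_seq (s t : seq (B * C)) :=
  [seq (x.1 * y.1, x.2 * y.2) | x <- s, y <- t].
Definition tact_seq (s : seq (B * C)) (g : G) :=
  [seq (gact B x.1 g, gact C x.2 g) | x <- s].

Lemma tens_eq_map (f : seq (B * C) -> seq (B * C)) :
    {morph f : s t / s ++ t} ->
    (forall c, tens_eq (f [:: (0, c)]) [::]) ->
    (forall b b' c,
       tens_eq (f [:: (b + b', c)]) (f [:: (b, c)] ++ f [:: (b', c)])) ->
    (forall b c c',
       tens_eq (f [:: (b, c + c')]) (f [:: (b, c)] ++ f [:: (b, c')])) ->
    (forall x b c,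
       tens_eq (f [:: (gscal B x * b, c)]) (f [:: (b, gscal C x * c)])) ->
  forall s t, tens_eq s t -> tens_eq (f s) (f t).
Proof.
move=> fD f0 fDl fDr fZ s t.
have fnil : f [::] = [::].
  move/(congr1 size)/eqP: (fD [::] [::]); rewrite size_cat -{1}[size _]addn0.
  by rewrite eqn_add2l => /eqP/esym/size0nil.
elim=> {s t}.
- by move=> s; constructor.
- by move=> s t _; apply: TensSym.
- by move=> s t u _ h _; apply: TensTrans.
- by move=> s s' t t' _ h _ h'; rewrite !fD; apply: TensCat.
- by move=> s t; rewrite !fD; constructor.
- by move=> c; rewrite fnil.
- by move=> b b' c; rewrite -[[:: (b, c); _]]cat1s fD.
- by move=> b c c'; rewrite -[[:: (b, c); _]]cat1s fD.
- exact: fZ.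
Qed.

Lemma topp_eq s t : tens_eq s t -> tens_eq (topp_seq s) (topp_seq t).
Proof.
apply: tens_eq_map => [s1 s2|c|b b' c|b c c'|x b c]; rewrite /topp_seq ?map_cat //=.
- by rewrite oppr0; constructor.
- by rewrite opprD; constructor.
- by constructor.
- by rewrite -mulrN; constructor.
Qed.

Lemma tact_eq g s t : tens_eq s t -> tens_eq (tact_seq s g) (tact_seq t g).
Proof.
apply: tens_eq_map => [s1 s2|c|b b' c|b c c'|x b c]; rewrite /tact_seq ?map_cat //=.
- by rewrite gact0; constructor.
- by rewrite gactD; constructor.
- by rewrite gactD; constructor.
- by rewrite !gactM !gact_scal; constructor.
Qed.

Lemma tmul_seqC s t : tens_eq (tmul_seq s t) (tmul_seq t s).
Proof.
rewrite /tmul_seq; elim: s => [|x s ih] /=; first by elim: t => [|y t ih] //=; constructor.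
apply: TensTrans (TensCat (TensRefl _) ih) _; apply/TensSym.
apply: TensTrans (tens_perm (permEl (perm_allpairs_consr
  (fun y z : B * C => (y.1 * z.1, y.2 * z.2)) t (fun=> x) (fun=> s)))) _.
apply: TensCat; last by constructor.
rewrite (eq_map (_ : _ =1 (fun y => (x.1 * y.1, x.2 * y.2)))); first by constructor.
by move=> y /=; rewrite ![x.1 * _]mulrC ![x.2 * _]mulrC.
Qed.

Lemma tmul_eq s s' t t' :
  tens_eq s s' -> tens_eq t t' -> tens_eq (tmul_seq s t) (tmul_seq s' t').
Proof.
have H u u' w : tens_eq u u' -> tens_eq (tmul_seq u w) (tmul_seq u' w).
  move=> h; apply: TensTrans (tmul_seqC _ _) _.
  apply: TensTrans _ (tmul_seqC _ _).
  elim: w => [|[d e] w ih]; first by constructor.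
  rewrite /tmul_seq /=; apply: TensCat ih.
  apply: (tens_eq_map _ _ _ _ _ h) => [s1 s2|c|b b' c|b c c'|x b c] /=.
  - by rewrite map_cat.
  - by rewrite mulr0; constructor.
  - by rewrite mulrDr; constructor.
  - by rewrite mulrDr; constructor.
  - by rewrite mulrCA [e * (_ * _)]mulrCA; constructor.
move=> h h'; apply: TensTrans (H _ _ _ h) _.
apply: TensTrans (tmul_seqC _ _) _; apply: TensTrans _ (tmul_seqC _ _).
exact: H.
Qed.

Definition tadd (x y : tens) := tpi (trepr x ++ trepr y).
Definition topp (x : tens) := tpi (topp_seq (trepr x)).
Definition tmul (x y : tens) := tpi (tmul_seq (trepr x) (trepr y)).
Definition tact (x : tens) (g : G) := tpi (tact_seq (trepr x) g).

Lemma tens_repr s : tens_eq s (trepr (tpi s)).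
Proof. by apply/tpiP; rewrite treprK. Qed.

Lemma tpiD s t : tpi (s ++ t) = tadd (tpi s) (tpi t).
Proof. by apply/tpiP/TensCat; apply: tens_repr. Qed.
Lemma tpiN s : tpi (topp_seq s) = topp (tpi s).
Proof. exact/tpiP/topp_eq/tens_repr. Qed.
Lemma tpiM s t : tpi (tmul_seq s t) = tmul (tpi s) (tpi t).
Proof. by apply/tpiP/tmul_eq; apply: tens_repr. Qed.
Lemma tactE s g : tact (tpi s) g = tpi (tact_seq s g).
Proof. by apply/tpiP/TensSym/tact_eq/tens_repr. Qed.

Lemma taddA : associative tadd.
Proof. by do 3![elim/tpiW=> ?]; rewrite -!tpiD catA. Qed.
Lemma taddC : commutative tadd.
Proof. by do 2![elim/tpiW=> ?]; rewrite -!tpiD; apply/tpiP; constructor. Qed.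
Lemma tadd0 : left_id (tpi [::]) tadd.
Proof. by elim/tpiW=> ?; rewrite -!tpiD. Qed.
Lemma taddN : left_inverse (tpi [::]) topp tadd.
Proof.
elim/tpiW=> s; rewrite -tpiN -tpiD; apply/tpiP.
elim: s => [|[b c] s ih] /=; first by constructor.
have h : perm_eq ((- b, c) :: topp_seq s ++ (b, c) :: s)
           ([:: (- b, c); (b, c)] ++ (topp_seq s ++ s)).
  by rewrite /= perm_cons -cat_rcons perm_sym -cat_cons perm_cat2r perm_sym perm_rcons.
apply: TensTrans (tens_perm h) _; rewrite -[[::]]/([::] ++ [::]).
apply: TensCat ih; apply: TensTrans (TensSym (TensDl _ _ _)) _.
by rewrite addNr; constructor.
Qed.
HB.instance Definition _ := GRing.isZmodule.Build tens taddA taddC tadd0 taddN.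

Lemma tmulC : commutative tmul.
Proof. by do 2![elim/tpiW=> ?]; rewrite -!tpiM; apply/tpiP/tmul_seqC. Qed.
Lemma tmulDl : left_distributive tmul +%R.
Proof.
move=> x y z; elim/tpiW: x => x; elim/tpiW: y => y; elim/tpiW: z => z.
by rewrite /GRing.add /= -!(tpiM, tpiD) /tmul_seq allpairs_cat.
Qed.
Lemma tmulA : associative tmul.
Proof.
move=> x y z; elim/tpiW: x => x; elim/tpiW: y => y; elim/tpiW: z => z.
elim: x => [|a x ih]; first by rewrite -!tpiM.
have D u v w : tmul (tadd u v) w = tadd (tmul u w) (tmul v w) := tmulDl u v w.
rewrite -cat1s tpiD !D ih; congr (tadd _ _) => {ih}.
rewrite -!tpiM /tmul_seq /= !cats0; congr tpi.
elim: y => [|b y ih] //=; rewrite map_cat ih; congr (_ ++ _).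
by rewrite -map_comp; apply: eq_map => c /=; rewrite !mulrA.
Qed.
Lemma tmul1 : left_id (pure 1 1) tmul.
Proof.
elim/tpiW=> s; rewrite -tpiM /tmul_seq /= cats0; congr tpi.
by rewrite -[RHS]map_id; apply: eq_map => -[b c] /=; rewrite !mul1r.
Qed.
HB.instance Definition _ :=
  GRing.Zmodule_isComPzRing.Build tens tmulA tmulC tmul1 tmulDl.

Lemma pureM b c b' c' : pure b c * pure b' c' = pure (b * b') (c * c').
Proof. by rewrite /GRing.mul /= -tpiM. Qed.

Lemma pureDl b b' c : pure (b + b') c = pure b c + pure b' c.
Proof. by rewrite /GRing.add /= -tpiD; apply/tpiP; constructor. Qed.

Lemma pureDr b c c' : pure b (c + c') = pure b c + pure b c'.
Proof. by rewrite /GRing.add /= -tpiD; apply/tpiP; constructor. Qed.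

Lemma pureZ x b c : pure (gscal B x * b) c = pure b (gscal C x * c).
Proof. by apply/tpiP; constructor. Qed.

Lemma tpiE s : tpi s = \sum_(x <- s) pure x.1 x.2.
Proof.
elim: s => [|[b c] s ih]; first by rewrite big_nil.
by rewrite big_cons -ih -cat1s tpiD.
Qed.

Lemma pureNl b c : pure (- b) c = - pure b c.
Proof. by rewrite /GRing.opp /= -tpiN. Qed.

Definition tinl (b : B) : tens := pure b 1.
Definition tinr (c : C) : tens := pure 1 c.

Lemma tinl_zmod : zmod_morphism tinl.
Proof. by move=> x y; rewrite /tinl pureDl pureNl. Qed.
Lemma tinl_monoid : monoid_morphism tinl.
Proof. by split=> // x y; rewrite /tinl pureM mulr1. Qed.
HB.instance Definition _ := GRing.isZmodMorphism.Build B tens tinl tinl_zmod.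
HB.instance Definition _ := GRing.isMonoidMorphism.Build B tens tinl tinl_monoid.

Lemma tact1 : tact^~ 1%g =1 id.
Proof.
elim/tpiW=> s; rewrite tactE; congr tpi.
by rewrite -[RHS]map_id; apply: eq_map => -[b c] /=; rewrite !gact_id.
Qed.
Lemma tactM x : act_morph tact x.
Proof.
move=> g h; elim/tpiW: x => s; rewrite !tactE; congr tpi; rewrite /tact_seq.
by rewrite -map_comp; apply: eq_map => -[b c] /=; rewrite !gact_comp.
Qed.
Lemma tact_zmod g : zmod_morphism (tact^~ g).
Proof.
move=> x y; elim/tpiW: x => x; elim/tpiW: y => y.
rewrite /GRing.opp /GRing.add /= -tpiN -tpiD !tactE -tpiN -tpiD; congr tpi.
rewrite /tact_seq map_cat; congr (_ ++ _); rewrite /topp_seq -!map_comp.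
by apply: eq_map => -[b c] /=; rewrite gactN.
Qed.
Lemma tact_pure b c g : tact (pure b c) g = pure (gact B b g) (gact C c g).
Proof. exact: tactE. Qed.
Lemma tact_monoid g : monoid_morphism (tact^~ g).
Proof.
split=> [|x y]; first by rewrite tact_pure !gact1.
elim/tpiW: x => x; elim/tpiW: y => y.
rewrite /GRing.mul /= -tpiM !tactE -tpiM; congr tpi.
rewrite /tact_seq /tmul_seq allpairs_mapl allpairs_mapr map_allpairs.
by apply: eq_allpairs => a b /=; rewrite !gactM.
Qed.
Lemma tact_scal c g : tact ((tinl \o gscal B) c) g = (tinl \o gscal B) c.
Proof. by rewrite /= tact_pure gact_scal gact1. Qed.

(* B (x)_k C with the diagonal action of G.                                   *)
Definition gtens : galgebra k G :=
  @GAlgebra k G tens (tinl \o gscal B)%FUN tact tact1 tactM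
    tact_zmod tact_monoid tact_scal.

End Tensor.

Section Sym.
Variables (k : fieldType) (G : finGroupType) (n : nat).
Variable rG : mx_representation k [set: G] n.

Lemma mpoly_ext (R : pzRingType) (f h : {rmorphism {mpoly k[n]} -> R}) :
  (forall c, f c%:MP = h c%:MP) -> (forall i, f 'X_i = h 'X_i) -> f =1 h.
Proof.
move=> fC fX p; rewrite [p]mpolyE !rmorph_sum; apply: eq_bigr => m _ /=.
rewrite -mul_mpolyC !rmorphM fC; congr (_ * _).
by rewrite mpolyXE_id !rmorph_prod; apply: eq_bigr => i _; rewrite !rmorphXn /= fX.
Qed.

(* The kG-module V of rG is 'rV_n with the right action u *m rG g, and S(V)   *)
(* is the polynomial ring on its standard basis.                              *)
Definition symv (u : 'rV[k]_n) : {mpoly k[n]} := \sum_i u 0 i *: 'X_i.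

Definition sym_act (p : {mpoly k[n]}) (g : G) : {mpoly k[n]} :=
  p \mPo [tuple symv (row i (rG g)) | i < n].

Lemma symv_linear : linear symv.
Proof.
move=> a u w; rewrite /symv scaler_sumr -big_split; apply: eq_bigr => i _ /=.
by rewrite !mxE scalerDl scalerA.
Qed.
HB.instance Definition _ := GRing.isLinear.Build k _ _ _ symv symv_linear.

Lemma sym_actX i g : sym_act 'X_i g = symv (row i (rG g)).
Proof. by rewrite /sym_act comp_mpolyXU -tnth_nth tnth_map tnth_ord_tuple. Qed.

Lemma sym_act_symv u g : sym_act (symv u) g = symv (u *m rG g).
Proof.
rewrite [LHS]raddf_sum mulmx_sum_row linear_sum; apply: eq_bigr => i _ /=.
by rewrite !linearZ /=; congr (_ *: _); apply: sym_actX.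
Qed.

Lemma symv_delta i : symv (delta_mx 0 i) = 'X_i.
Proof.
rewrite /symv (bigD1 i) //= mxE !eqxx scale1r big1 ?addr0 // => j /negPf ij.
by rewrite mxE ij andbF scale0r.
Qed.

Lemma sym_act_zmod g : zmod_morphism (sym_act^~ g).
Proof. by move=> p q; rewrite /sym_act rmorphB. Qed.
Lemma sym_act_monoid g : monoid_morphism (sym_act^~ g).
Proof. by split=> [|p q]; rewrite /sym_act ?rmorph1 ?rmorphM. Qed.
Lemma sym_act_scal c g : sym_act c%:MP g = c%:MP.
Proof. exact: comp_mpolyC. Qed.

Lemma sym_act1 : sym_act^~ 1%g =1 id.
Proof.
move=> p; rewrite /sym_act repr_mx1 -[RHS]comp_mpoly_id; congr (_ \mPo _).
apply: eq_from_tnth => i; rewrite !tnth_map tnth_ord_tuple.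
by rewrite row1 symv_delta.
Qed.

Lemma sym_actM p : act_morph sym_act p.
Proof.
move=> g h; rewrite /sym_act.
set tg := [tuple symv (row i (rG g)) | i < n].
set th := [tuple symv (row i (rG h)) | i < n].
apply: (mpoly_ext (f := comp_mpoly [tuple symv (row i (rG (g * h)%g)) | i < n])
          (h := (comp_mpoly th \o comp_mpoly tg)%FUN)) => [c|i] /=.
  by rewrite !comp_mpolyC.
have := sym_actX i (g * h)%g; rewrite /sym_act => ->.
have := sym_actX i g; rewrite /sym_act -/tg => ->.
have := sym_act_symv (row i (rG g)) h; rewrite /sym_act -/th => ->.
by rewrite repr_mxM ?inE // row_mul.
Qed.

Definition sym : galgebra k G :=
  @GAlgebra k G {mpoly k[n]} (@mpolyC n k) sym_act sym_act1 sym_actM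
    sym_act_zmod sym_act_monoid sym_act_scal.

Variable v : 'rV[k]_n.
Hypothesis vG : (v <= rfix_mx rG [set: G])%MS.

Lemma symv_inv : @ginv k G sym (symv v - 1).
Proof.
move=> g; rewrite -[X in _ - X]/(1 : sym) gactD gactN gact1; congr (_ - _).
by rewrite [LHS]sym_act_symv (rfix_mxP _ vG).
Qed.

(* S(V)/(v-1) *)
Definition symquot : galgebra k G := gquot symv_inv.

Lemma fix_mxmodule : mxmodule rG <<v>>%MS.
Proof.
apply/mxmoduleP => g _; rewrite (eqmxMr _ (genmxE v)) genmxE.
by rewrite (rfix_mxP _ vG) ?inE.
Qed.

End Sym.

(* S(V/kv): the factor module is represented on 'rV_(\rank (cokermx <<v>>)).  *)
Definition symfact (k : fieldType) (G : finGroupType) (n : nat)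
    (rG : mx_representation k [set: G] n) (v : 'rV[k]_n)
    (vG : (v <= rfix_mx rG [set: G])%MS) : galgebra k G :=
  sym (factmod_repr (fix_mxmodule vG)).

(* Isomorphism of B-algebras with G-action.                                   *)
Definition tens_iso (k : fieldType) (G : finGroupType)
    (B C C' : galgebra k G) : Prop :=
  exists f : gtens B C -> gtens B C',
    [/\ ghom f, bijective f & forall b, f (tinl C b) = tinl C' b].

Section Universal.
Variables (k : fieldType) (G : finGroupType).

Lemma gquot_lift (A D : galgebra k G) (a : A) (a_inv : ginv a) (f : A -> D) :
  ghom f -> f a = 0 ->
  exists h : gquot a_inv -> D, ghom h /\ forall x, h (qpi a x) = f x.
Proof.
case=> fz [f1 fM] fc fg fa.
pose h (x : gquot a_inv) := f (qrepr x).
have hE x : h (qpi a x) = f x.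
  have [c e] : exists c, qrepr (qpi a x) - x = c * a by apply/qpiP; rewrite qreprK.
  by apply/eqP; rewrite -subr_eq0 -fz e fM fa mulr0.
exists h; split=> //; split.
- elim/qpiW=> x; elim/qpiW=> y; rewrite -[X in h X]/(qpi a x - qpi a y).
  by rewrite -rmorphB !hE fz.
- split; first by rewrite -[X in h X]/(1 : quot a) -(rmorph1 (qpi a)) hE.
  by elim/qpiW=> x; elim/qpiW=> y; rewrite -[X in h X]/(qpi a x * qpi a y) -rmorphM !hE fM.
- by move=> c; rewrite [LHS]hE fc.
- elim/qpiW=> x g; rewrite -[X in h X]/(qact (qpi a x) g) qactE //.
  by rewrite !hE fg.
Qed.

Lemma tens_lift (B C : galgebra k G) (M : zmodType) (f : B -> C -> M) :
    (forall b b' c, f (b + b') c = f b c + f b' c) ->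
    (forall b c c', f b (c + c') = f b c + f b c') ->
    (forall x b c, f (gscal B x * b) c = f b (gscal C x * c)) ->
  exists h : tens B C -> M,
    zmod_morphism h /\ forall b c, h (pure b c) = f b c.
Proof.
move=> fDl fDr fZ.
pose F (s : seq (B * C)) := \sum_(x <- s) f x.1 x.2.
have f0 c : f 0 c = 0 by apply: (addrI (f 0 c)); rewrite -fDl !addr0.
have fN b c : f (- b) c = - f b c.
  by apply/eqP; rewrite -addr_eq0 -fDl addNr f0.
have FE s t : tens_eq s t -> F s = F t.
  rewrite /F; elim=> {s t} //=.
  - by move=> s t u _ -> _ ->.
  - by move=> s s' t t' _ h _ h'; rewrite !big_cat h h'.
  - by move=> s t; rewrite !big_cat /= addrC.
  - by move=> c; rewrite big_seq1 big_nil f0.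
  - by move=> b b' c; rewrite !big_cons !big_nil /= !addr0 fDl.
  - by move=> b c c'; rewrite !big_cons !big_nil /= !addr0 fDr.
  - by move=> x b c; rewrite !big_seq1 /= fZ.
pose h (x : tens B C) := F (trepr x).
have hE s : h (tpi s) = F s by apply: FE; apply/tpiP; rewrite treprK.
exists h; split=> [|b c]; last by rewrite hE /F big_seq1.
elim/tpiW=> s; elim/tpiW=> t.
rewrite {1}/GRing.opp {1}/GRing.add /= -tpiN -tpiD !hE /F big_cat; congr (_ + _).
by rewrite big_map -sumrN; apply: eq_bigr => x _; rewrite fN.
Qed.

Lemma sym_lift (n : nat) (rG : mx_representation k [set: G] n)
    (A : galgebra k G) (f : 'rV[k]_n -> A) :
    zmod_morphism f ->
    (forall c u, f (c *: u) = gscal A c * f u) ->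
    (forall u g, f (u *m rG g) = gact A (f u) g) ->
  exists h : sym rG -> A, ghom h /\ forall u, h (symv u) = f u.
Proof.
move=> fB fZ fg.
have f0 : f 0 = 0 by rewrite -(subrr 0) fB subrr.
have fsum I (r : seq I) (F : I -> 'rV[k]_n) :
    f (\sum_(i <- r) F i) = \sum_(i <- r) f (F i).
  elim: r => [|i r ih]; first by rewrite !big_nil.
  rewrite !big_cons -ih -[\sum_(j <- r) _ in LHS]opprK fB -[- \sum_(j <- r) _]sub0r.
  by rewrite fB f0 sub0r opprK.
have [h [hC hX]] : exists h : {rmorphism {mpoly k[n]} -> A},
    (forall c, h c%:MP = gscal A c) /\ (forall i, h 'X_i = f (delta_mx 0 i)).
  have [A0|A1] := eqVneq (1 : A) 0.
    have tr (x : A) : x = 0 by rewrite -[x]mul1r A0 mul0r.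
    pose h (_ : {mpoly k[n]}) : A := 0.
    have hz : zmod_morphism h by move=> x y; rewrite /h subrr.
    have hm : monoid_morphism h by split=> [|x y]; rewrite /h ?A0 ?mulr0.
    pose H : {rmorphism {mpoly k[n]} -> A} := HB.pack h
      (GRing.isZmodMorphism.Build _ _ h hz) (GRing.isMonoidMorphism.Build _ _ h hm).
    by exists H; split=> [c|i]; rewrite [RHS]tr.
  pose A' : comNzRingType := HB.pack (gcarrier A)
    (GRing.PzSemiRing_isNonZero.Build (gcarrier A) A1).
  pose s : {rmorphism k -> A'} := gscal A.
  pose H : {rmorphism {mpoly k[n]} -> A'} :=
    mmap s (fun i => f (delta_mx 0 i) : A').
  exists H.
  by split=> [c|i] /=; rewrite ?mmapC ?mmapX ?mmap1U.
have hV u : h (symv u) = f u.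
  rewrite rmorph_sum {2}[u]row_sum_delta fsum; apply: eq_bigr => i _.
  by rewrite fZ /= -mul_mpolyC rmorphM hC hX.
exists h; split=> //; split; [exact: rmorphB| |exact: hC|].
  by split; [exact: rmorph1|exact: rmorphM].
move=> p g.
pose ag : {rmorphism A -> A} := HB.pack (gact A ^~ g)
  (GRing.isZmodMorphism.Build _ _ (gact A ^~ g) (gact_zmod A g))
  (GRing.isMonoidMorphism.Build _ _ (gact A ^~ g) (gact_monoid A g)).
pose sg : {rmorphism {mpoly k[n]} -> {mpoly k[n]}} := HB.pack (sym_act rG ^~ g)
  (GRing.isZmodMorphism.Build _ _ (sym_act rG ^~ g) (sym_act_zmod rG g))
  (GRing.isMonoidMorphism.Build _ _ (sym_act rG ^~ g) (sym_act_monoid rG g)).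
apply: (mpoly_ext (f := (h \o sg)%FUN) (h := (ag \o h)%FUN)) => [c|i] /=.
  by rewrite sym_act_scal hC gact_scal.
by rewrite sym_actX hV hX -fg rowE.
Qed.

End Universal.

(* Main.v *)
(* If A has an element of trace 1, averaging turns any k-linear map V -> A    *)
(* into an equivariant one, without changing it where it was equivariant.     *)
(* Hence equivariant linear maps V -> A' lift along a surjection A -> A' in   *)
(* Ts_G, and a lift may be chosen to send v to 1 if the given map does.  With *)
(* the universal properties of S(V), S(V)/(v-1) and the tensor product this   *)
(* gives the lifting properties; membership in Ts_G only requires an element  *)
(* of trace 1.  In (1) this is the class of f, since v becomes 1 and a        *)
(* relative trace from H can be divided by the index of H.  In (2), averaging *)
(* a linear form that is 1 at v gives an equivariant theta : V -> B with      *)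
(* theta v = 1, and u |-> 1 (x) u - theta u (x) 1 splits off S(V/kv).         *)
Require Import Defs.
From HB Require Import structures.
From mathcomp Require Import all_boot all_order all_algebra all_fingroup.
From mathcomp Require Import all_solvable all_character.
From mathcomp Require Import mpoly.
Import Defs.

Set Implicit Arguments.
Unset Strict Implicit.
Unset Printing Implicit Defensive.

Import GRing.Theory.

Local Open Scope ring_scope.

(** An element [l] of trace 1 in A turns [average l] into a projection of Hom_k(V, A) onto the
    equivariant maps: the values are always equivariant ([equivariant_average]), and equivariant
    maps are fixed ([average_equivariant]). So along a surjection A -> A' in Ts_G an equivariant
    linear map V -> A' is lifted linearly on a basis and then averaged ([equivariant_lift]). If it
    sends a fixed vector v != 0 to 1, the linear lift is first corrected to do the same
    ([equivariant_lift1]).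

    Morphisms out of S(V) are equivariant linear maps on V, those out of S(V)/(v-1) are the ones
    with v |-> 1, and those out of B (x) C are pairs of morphisms. Hence the lifting properties in
    (1) and (3).

    For (2), averaging in B yields an equivariant theta : V -> B with theta v = 1. Writing u' for
    the class of u in V/kv, the assignments u |-> theta u (x) 1 + 1 (x) u' and u' |-> 1 (x) u -
    theta u (x) 1 extend to mutually inverse B-algebra maps ([tens_iso_symquot]). *)

#[local] Arguments tinr {k G} B {C} c.

(** * Morphisms, traces, and tensor products as coproducts *)

Section Morphisms.
Variables (k : fieldType) (G : finGroupType).
Implicit Types A B C D : galgebra k G.

Lemma ghom_rmorphism A B (f : A -> B) :
  ghom f -> exists F : {rmorphism A -> B}, f = F.
Proof.
case=> fz fm _ _.
pose F : {rmorphism A -> B} := HB.pack f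
  (GRing.isZmodMorphism.Build _ _ f fz) (GRing.isMonoidMorphism.Build _ _ f fm).
by exists F.
Qed.

Lemma ghom_id A : ghom (@id A).
Proof. by split. Qed.

Lemma ghom_comp A B C (f : B -> C) (h : A -> B) :
  ghom f -> ghom h -> ghom (f \o h).
Proof.
move=> [fz [f1 fM] fc fg] [hz [h1 hM] hc hg]; split.
- by move=> x y /=; rewrite hz fz.
- by split=> [|x y] /=; rewrite ?h1 ?hM.
- by move=> c /=; rewrite hc.
- by move=> a g /=; rewrite hg.
Qed.

Lemma gact_sum A g (I : Type) (r : seq I) (P : pred I) (F : I -> A) :
  gact A (\sum_(i <- r | P i) F i) g = \sum_(i <- r | P i) gact A (F i) g.
Proof.
by apply: (big_morph (gact A ^~ g)) => [x y|]; rewrite ?gactD ?gact0.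
Qed.

Lemma ghom_gtr A B (f : A -> B) (H : {set G}) a :
  ghom f -> f (gtr H a) = gtr H (f a).
Proof.
move=> fh; have [F eF] := ghom_rmorphism fh.
rewrite /gtr {1}eF rmorph_sum -eF; apply: eq_bigr => h _.
by case: fh.
Qed.

(** The trace is linear over the invariants, so an invariant a is the trace of a * l. *)
Lemma in_Ts_gtr1 A : fin_gen A -> (exists a : A, gtr [set: G] a = 1) -> in_Ts A.
Proof.
move=> fgA [l l1]; split=> // a aG; exists (a * l).
rewrite -[RHS]mulr1 -l1 mulr_sumr; apply: eq_bigr => g _.
by rewrite gactM aG.
Qed.

Lemma gtr1_in_Ts A : in_Ts A -> exists a : A, gtr [set: G] a = 1.
Proof. by case=> _; apply=> g; apply: gact1. Qed.

(** Split G into right cosets Hy: each contributes tr_H(a) moved by y, which is 1. *)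
Lemma gtr_subgroup A (H : {group G}) (a : A) :
  gtr H a = 1 -> gtr [set: G] a = #|[set: G] : H|%g%:R.
Proof.
move=> a1; rewrite /gtr (set_partition_big _ (rcosets_partition (subsetT H))) /=.
rewrite /indexg -sum1_card natr_sum; apply: eq_bigr => _ /rcosetsP[y _ ->].
rewrite -rcosetE /rcoset big_imset /=; last by move=> x z _ _ /mulIg.
under eq_bigr => h _ do rewrite gact_comp.
by rewrite -gact_sum -/(gtr H a) a1 gact1.
Qed.

(** The index of a Sylow p-subgroup is prime to p, hence invertible in k, and traces commute with
    scalars. *)
Lemma gtr_Sylow A p (H : {group G}) (a : A) :
    p \in [pchar k] -> (p.-Sylow([set: G]) H)%g ->
  gtr H a = 1 -> exists b : A, gtr [set: G] b = 1.
Proof.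
move=> charkp /and3P[_ _ p'i] /gtr_subgroup a1.
have i0 : #|[set: G] : H|%g%:R != 0 :> k.
  rewrite -(dvdn_pcharf charkp) -prime.p'natE //; exact: (pcharf_prime charkp).
exists (gscal A (#|[set: G] : H|%g%:R^-1) * a).
rewrite /gtr; under eq_bigr => g _ do rewrite gactM gact_scal.
rewrite -mulr_sumr -/(gtr _ a) a1 -(rmorph_nat (gscal A)) -rmorphM.
by rewrite mulVf ?rmorph1.
Qed.

Lemma ghom_tinl B C : ghom (tinl C : B -> gtens B C).
Proof.
split=> [|||b g] //; [exact: rmorphB|by split; [exact: rmorph1|exact: rmorphM]|].
by rewrite [RHS]tact_pure gact1.
Qed.

Lemma ghom_tinr B C : ghom (tinr B : C -> gtens B C).
Proof.
have tz : zmod_morphism (tinr B : C -> gtens B C).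
  move=> x y; apply/eqP; rewrite eq_sym subr_eq; apply/eqP.
  by rewrite /tinr -[LHS]/(pure 1 x) -pureDr subrK.
split=> [||c|c g] //.
- by split=> // x y; rewrite /tinr [RHS]pureM mulr1.
- by rewrite /tinr -[gscal C c]mulr1 -pureZ mulr1.
- by rewrite [RHS]tact_pure gact1.
Qed.

Lemma pure_tinl_tinr B C (b : B) (c : C) :
  pure b c = tinl C b * tinr B c :> gtens B C.
Proof. by rewrite [RHS]pureM mul1r mulr1. Qed.

Lemma gtens_lift B C D (f : B -> D) (h : C -> D) :
    ghom f -> ghom h ->
  exists F : gtens B C -> D,
    [/\ ghom F, forall b, F (tinl C b) = f b & forall c, F (tinr B c) = h c].
Proof.
move=> fh hh.
have [F0 eF0] := ghom_rmorphism fh; have [H0 eH0] := ghom_rmorphism hh.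
have [_ _ fc fg] := fh; have [_ _ hc hg] := hh.
have [|||F [Fz FE]] := @tens_lift k G B C D (fun b c => f b * h c).
- by move=> b b' c; rewrite eF0 rmorphD mulrDl.
- by move=> b c c'; rewrite eH0 rmorphD mulrDr.
- move=> x b c; rewrite eF0 eH0 !rmorphM -eF0 -eH0 fc hc mulrA; congr (_ * _).
  exact: mulrC.
have FS I r (E : I -> tens B C) : F (\sum_(i <- r) E i) = \sum_(i <- r) F (E i).
  pose Fa : {additive tens B C -> D} :=
    HB.pack F (GRing.isZmodMorphism.Build _ _ F Fz).
  exact: (raddf_sum Fa).
exists F; split=> [|b|c]; last 2 first.
- by rewrite FE eH0 rmorph1 mulr1.
- by rewrite FE eF0 rmorph1 mul1r.
split=> [//||c|x g].
- split=> [|x y]; first by rewrite [LHS]FE eF0 eH0 !rmorph1 mulr1.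
  elim/tpiW: x => s; elim/tpiW: y => t; rewrite !tpiE !FS.
  rewrite mulr_suml mulr_suml FS; apply: eq_bigr => -[b c] _ /=.
  rewrite !mulr_sumr FS; apply: eq_bigr => -[b' c'] _ /=.
  by rewrite pureM !FE eF0 eH0 !rmorphM mulrACA.
- by rewrite [LHS]FE eH0 rmorph1 mulr1 fc.
- elim/tpiW: x => s; rewrite tpiE.
  rewrite -[X in gact _ X _]/(\sum_(x <- s) pure x.1 x.2 : gtens B C).
  rewrite gact_sum !FS gact_sum; apply: eq_bigr => -[b c] _ /=.
  by rewrite tact_pure !FE fg hg gactM.
Qed.

Lemma gtens_ext B C D (f h : gtens B C -> D) :
    ghom f -> ghom h -> (forall b, f (tinl C b) = h (tinl C b)) ->
    (forall c, f (tinr B c) = h (tinr B c)) -> f =1 h.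
Proof.
move=> fh hh fhl fhr; have [F eF] := ghom_rmorphism fh.
have [H eH] := ghom_rmorphism hh.
elim/tpiW=> s; rewrite tpiE eF eH !rmorph_sum -eF -eH.
apply: eq_bigr => -[b c] _ /=.
by rewrite pure_tinl_tinr eF eH !rmorphM -eF -eH fhl fhr.
Qed.

Lemma fin_gen_surj A B (f : A -> B) : ghom f -> surj f -> fin_gen A -> fin_gen B.
Proof.
move=> fh fs [s sP]; have [F eF] := ghom_rmorphism fh.
exists (map f s) => P [Pc PD PM] Ps b; have [a <-] := fs b.
apply: (sP (fun a => P (f a))) => [|{}a a_s]; last by apply: Ps; apply: map_f.
split=> [c|x y|x y]; first by case: fh => _ _ -> _.
  by rewrite eF rmorphD -eF; apply: PD.
by rewrite eF rmorphM -eF; apply: PM.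
Qed.

Lemma fin_gen_gtens B C : fin_gen B -> fin_gen C -> fin_gen (gtens B C).
Proof.
move=> [s sP] [t tP]; exists (map (tinl C) s ++ map (@tinr _ _ B C) t) => P Psub Pst.
have [Pc PD PM] := Psub.
have Pl b : P (tinl C b).
  apply: (sP (fun b => P (tinl C b))) => [|{}b b_s]; last first.
    by apply: Pst; rewrite mem_cat map_f.
  split=> [//|x y Px Py|x y Px Py].
    by rewrite rmorphD; apply: PD.
  by rewrite rmorphM; apply: PM.
have [R eR] := ghom_rmorphism (ghom_tinr B C).
have Pr c : P (tinr B c).
  apply: (tP (fun c => P (tinr B c))) => [|{}c c_t]; last first.
    by apply: Pst; rewrite mem_cat orbC map_f.
  split=> [x|x y Px Py|x y Px Py].
  - by case: (ghom_tinr B C) => _ _ -> _.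
  - by rewrite eR rmorphD -eR; apply: PD.
  - by rewrite eR rmorphM -eR; apply: PM.
elim/tpiW=> u; rewrite tpiE; elim/big_ind: _ => [||[b c] _].
- by have := Pl 0; rewrite rmorph0.
- exact: PD.
- by rewrite /= pure_tinl_tinr; apply: PM; [apply: Pl|apply: Pr].
Qed.

(** The element of trace 1 comes from B alone, so the lemma applies to C = S(V) and C =
    S(V)/(v-1). *)
Lemma in_Ts_gtens B C : in_Ts B -> fin_gen C -> in_Ts (gtens B C).
Proof.
move=> BTs Cfg; apply: in_Ts_gtr1; first by case: BTs => Bfg _; apply: fin_gen_gtens.
have [l l1] := gtr1_in_Ts BTs; exists (tinl C l).
by rewrite -(ghom_gtr _ _ (ghom_tinl B C)) l1.
Qed.

End Morphisms.

(** * Averaging and lifting of equivariant linear maps *)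

Section EquivariantLinear.
Variables (k : fieldType) (G : finGroupType) (n : nat).
Variable rG : mx_representation k [set: G] n.
Implicit Types (A B D : galgebra k G) (u v : 'rV[k]_n).

(** A [galgebra] carries only its structure morphism from k, so k-linearity is phrased through
    [gscal]. *)
Definition linear_to A (f : 'rV[k]_n -> A) :=
  zmod_morphism f /\ forall c u, f (c *: u) = gscal A c * f u.

Definition equivariant A (f : 'rV[k]_n -> A) :=
  forall u g, f (u *m rG g) = gact A (f u) g.

Lemma linear_to_sum A (f : 'rV[k]_n -> A) u : linear_to f ->
  f u = \sum_i gscal A (u 0 i) * f (delta_mx 0 i).
Proof.
case=> fz fZ; pose F : {additive 'rV[k]_n -> A} :=
  HB.pack f (GRing.isZmodMorphism.Build _ _ f fz).
rewrite {1}[u]row_sum_delta -[LHS]/(F _) raddf_sum.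
by apply: eq_bigr => i _; rewrite /= fZ.
Qed.

Lemma linear_to_comp A D (f : 'rV[k]_n -> A) (h : A -> D) :
  ghom h -> linear_to f -> linear_to (h \o f).
Proof.
move=> [hz [_ hM] hc _] [fz fZ].
by split=> [x y|c u] /=; rewrite ?fz ?hz // fZ hM hc.
Qed.

Lemma equivariant_comp A D (f : 'rV[k]_n -> A) (h : A -> D) :
  ghom h -> equivariant f -> equivariant (h \o f).
Proof. by move=> [_ _ _ hg] fg u g /=; rewrite fg hg. Qed.

Lemma linear_toD A (f h : 'rV[k]_n -> A) :
  linear_to f -> linear_to h -> linear_to (fun u => f u + h u).
Proof.
move=> [fz fZ] [hz hZ]; split=> [x y|c u]; first by rewrite fz hz opprD addrACA.
by rewrite fZ hZ mulrDr.
Qed.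

Lemma equivariantD A (f h : 'rV[k]_n -> A) :
  equivariant f -> equivariant h -> equivariant (fun u => f u + h u).
Proof. by move=> fg hg u g; rewrite fg hg gactD. Qed.

Lemma linear_toN A (f : 'rV[k]_n -> A) :
  linear_to f -> linear_to (fun u => - f u).
Proof.
by move=> [fz fZ]; split=> [x y|c u]; rewrite ?fz ?opprD // fZ mulrN.
Qed.

Lemma equivariantN A (f : 'rV[k]_n -> A) :
  equivariant f -> equivariant (fun u => - f u).
Proof. by move=> fg u g; rewrite fg gactN. Qed.

Lemma linear_to_symv : linear_to (@symv k n : _ -> sym rG).
Proof.
split=> [x y|c u]; first exact: linearB.
by rewrite linearZ /= -mul_mpolyC.
Qed.

Lemma equivariant_symv : equivariant (@symv k n : _ -> sym rG).
Proof. by move=> u g; rewrite [RHS]sym_act_symv. Qed.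

Lemma sym_ext D (f h : sym rG -> D) :
  ghom f -> ghom h -> (forall u, f (symv u) = h (symv u)) -> f =1 h.
Proof.
move=> fh hh fhV; have [F eF] := ghom_rmorphism fh.
have [H eH] := ghom_rmorphism hh.
have [_ _ fc _] := fh; have [_ _ hc _] := hh.
move=> p; rewrite eF eH; apply: (@mpoly_ext k n D F H) => [c|i].
  by rewrite -eF -eH; have := fc c; rewrite /= => ->; have := hc c; rewrite /= => ->.
by rewrite -symv_delta -eF -eH fhV.
Qed.

Lemma fin_gen_sym : fin_gen (sym rG).
Proof.
exists [seq 'X_i | i <- enum 'I_n] => P [Pc PD PM] PX p.
rewrite [p]mpolyE; elim/big_ind: _ => [||m _].
- by rewrite -(rmorph0 (@mpolyC n k)).
- exact: PD.
- rewrite -mul_mpolyC; apply: (PM _ _); first exact: Pc.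
  rewrite mpolyXE_id; elim/big_ind: _ => [||i _].
  + by rewrite -(rmorph1 (@mpolyC n k)).
  + exact: PM.
  elim: (m i) => [|j ih]; first by rewrite expr0 -(rmorph1 (@mpolyC n k)).
  rewrite exprS; apply: PM => //; apply: PX; apply/mapP.
  by exists i; rewrite ?mem_enum.
Qed.

(* The trace of [l * psi] in Hom_k(V, A) with its conjugation action.         *)
Definition average A (l : A) (psi : 'rV[k]_n -> A) u : A :=
  \sum_g gact A (l * psi (u *m rG g^-1%g)) g.

Lemma linear_to_average A l (psi : 'rV[k]_n -> A) :
  linear_to psi -> linear_to (average l psi).
Proof.
move=> [pz pZ]; split=> [x y|c u]; rewrite /average.
  rewrite -sumrB; apply: eq_bigr => g _.
  by rewrite mulmxBl pz mulrBr gactD gactN.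
rewrite mulr_sumr; apply: eq_bigr => g _.
by rewrite -scalemxAl pZ mulrCA !gactM gact_scal.
Qed.

Lemma equivariant_average A l (psi : 'rV[k]_n -> A) :
  equivariant (average l psi).
Proof.
(* Translating the summation index by h absorbs the action of h. *)
move=> u h; rewrite /average gact_sum (reindex_inj (mulIg h)) /=.
apply: eq_bigr => g _; rewrite gact_comp invMg repr_mxM ?inE //.
by rewrite mulmxA -[u *m _ *m _]mulmxA -repr_mxM ?inE // mulgV repr_mx1 mulmx1.
Qed.

(** Each summand becomes (l g) * psi u, and the l g add up to 1. The hypothesis concerns the single
    vector u, so the lemma also applies at u = v to a map that is not equivariant elsewhere. *)
Lemma average_equivariant A l (psi : 'rV[k]_n -> A) u :
    gtr [set: G] l = 1 -> (forall g, psi (u *m rG g) = gact A (psi u) g) ->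
  average l psi u = psi u.
Proof.
move=> l1 pg; rewrite -[RHS]mul1r -l1 mulr_suml.
rewrite [RHS](eq_bigl xpredT) => [|g]; last by rewrite inE.
apply: eq_bigr => g _.
by rewrite pg gactM -gact_comp mulVg gact_id.
Qed.

Lemma ghom_average A D (q : A -> D) l (psi : 'rV[k]_n -> A) u :
  ghom q -> q (average l psi u) = average (q l) (q \o psi) u.
Proof.
move=> qh; have [Q eQ] := ghom_rmorphism qh; have [_ [_ qM] _ qg] := qh.
rewrite /average {1}eQ rmorph_sum -eQ.
by apply: eq_bigr => g _; rewrite qg qM.
Qed.

(** A coordinate form normalised at a nonzero entry of v. Its values are scalars, hence G-invariant,
    although t need not be equivariant. *)
Lemma linear_form A v : v != 0 ->
  exists t : 'rV[k]_n -> A, 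
    [/\ linear_to t, t v = 1 & forall u g, gact A (t u) g = t u].
Proof.
case/rV0Pn=> i vi; exists (fun u => gscal A (u 0 i / v 0 i)).
split=> [|| u g]; last exact: gact_scal.
  split=> [x y|c u]; first by rewrite !mxE mulrBl rmorphB.
  by rewrite mxE -mulrA rmorphM.
by rewrite mulfV ?rmorph1.
Qed.

Variables (A A' : galgebra k G) (q : A -> A').
Hypotheses (ATs : in_Ts A) (qh : ghom q) (qs : surj q).

Lemma linear_to_lift (phi : 'rV[k]_n -> A') : linear_to phi ->
  exists psi : 'rV[k]_n -> A, linear_to psi /\ q \o psi =1 phi.
Proof.
move=> pl; have [a aE] := fin_all_exists (fun i => qs (phi (delta_mx 0 i))).
exists (fun u => \sum_i gscal A (u 0 i) * a i); split.
  split=> [x y|c u].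
    by rewrite -sumrB; apply: eq_bigr => i _; rewrite !mxE rmorphB mulrBl.
  by rewrite mulr_sumr; apply: eq_bigr => i _; rewrite mxE rmorphM mulrA.
have [Q eQ] := ghom_rmorphism qh; have [_ [_ qM] qc _] := qh.
move=> u /=; rewrite (linear_to_sum _ pl) {1}eQ rmorph_sum -eQ.
by apply: eq_bigr => i _; rewrite qM qc aE.
Qed.

(** By [ghom_average], q turns the average of psi into that of phi, with weight q l again of trace
    1; phi is equivariant and so unchanged. *)
Lemma average_lift (psi : 'rV[k]_n -> A) (phi : 'rV[k]_n -> A') l :
    gtr [set: G] l = 1 -> equivariant phi -> q \o psi =1 phi ->
  q \o average l psi =1 phi.
Proof.
move=> l1 pg qpsi u /=; rewrite ghom_average // average_equivariant //.
- by rewrite -(ghom_gtr _ _ qh) l1; case: qh => _ [].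
- by move=> g; rewrite !qpsi pg.
Qed.

Lemma equivariant_lift (phi : 'rV[k]_n -> A') :
    linear_to phi -> equivariant phi ->
  exists Psi : 'rV[k]_n -> A, [/\ linear_to Psi, equivariant Psi & q \o Psi =1 phi].
Proof.
move=> pl pg; have [psi [psil qpsi]] := linear_to_lift pl.
have [l l1] := gtr1_in_Ts ATs; exists (average l psi); split.
- exact: linear_to_average.
- exact: equivariant_average.
- exact: average_lift.
Qed.

Lemma equivariant_lift1 (phi : 'rV[k]_n -> A') v :
    linear_to phi -> equivariant phi ->
    v != 0 -> (v <= rfix_mx rG [set: G])%MS -> phi v = 1 ->
  exists Psi : 'rV[k]_n -> A,
    [/\ linear_to Psi, equivariant Psi, q \o Psi =1 phi & Psi v = 1].
Proof.
move=> pl pg v0 vG pv; have [psi [psil qpsi]] := linear_to_lift pl.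
have [t [tl tv tg]] := linear_form A v0.
have [l l1] := gtr1_in_Ts ATs; have [Q eQ] := ghom_rmorphism qh.
(* The correction forces the value 1 at v and is killed by q, since q (psi v) = phi v = 1. Averaging
   then keeps the value at v, because v and 1 are both fixed by G. *)
pose psi1 u := psi u + t u * (1 - psi v).
have psi1v : psi1 v = 1 by rewrite /psi1 tv mul1r addrC subrK.
exists (average l psi1); split.
- apply: linear_to_average; apply: linear_toD => //.
  by case: tl => tz tZ; split=> [x y|c u]; rewrite ?tz ?mulrBl // tZ mulrA.
- exact: equivariant_average.
- apply: average_lift => // u; rewrite -qpsi /psi1 /= eQ rmorphD rmorphM rmorphB.
  by rewrite rmorph1 -eQ [q (psi v)]qpsi pv subrr mulr0 addr0.
- rewrite average_equivariant // => g.
  by rewrite (rfix_mxP _ vG) ?inE // psi1v gact1.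
Qed.

End EquivariantLinear.

(** * The algebra S(V)/(v-1): universal property, s-projectivity, splitting over B *)

Section SymmetricQuotient.
Variables (k : fieldType) (G : finGroupType) (n : nat).
Variables (rG : mx_representation k [set: G] n) (v : 'rV[k]_n).
Hypothesis vG : (v <= rfix_mx rG [set: G])%MS.
Implicit Types (A B D : galgebra k G) (u : 'rV[k]_n).

Let r : {mpoly k[n]} := symv v - 1.

Lemma ghom_qpi : ghom (@qpi k G (sym rG) r : sym rG -> symquot vG).
Proof.
split=> [|||x g] //; [exact: rmorphB|by split; [exact: rmorph1|exact: rmorphM]|].
by rewrite [RHS]qactE //; apply: symv_inv.
Qed.

Lemma qpi_symv : (@qpi k G (sym rG) r (symv v) : symquot vG) = 1.
Proof. by apply/qpiP; exists 1; rewrite mul1r. Qed.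

Lemma symquot_lift D (f : 'rV[k]_n -> D) :
    linear_to f -> equivariant rG f -> f v = 1 ->
  exists F : symquot vG -> D,
    ghom F /\ forall u, F (@qpi k G (sym rG) r (symv u)) = f u.
Proof.
move=> [fz fZ] fg fv; have [h [hh hE]] := sym_lift fz fZ fg.
have [|F [Fh FE]] := gquot_lift (symv_inv vG) hh.
  have [H eH] := ghom_rmorphism hh.
  by rewrite eH rmorphB rmorph1 -eH hE fv subrr.
by exists F; split=> // u; rewrite FE.
Qed.

Lemma symquot_ext D (f h : symquot vG -> D) :
    ghom f -> ghom h ->
    (forall u, f (@qpi k G (sym rG) r (symv u)) =
               h (@qpi k G (sym rG) r (symv u))) ->
  f =1 h.
Proof.
move=> fh hh fhV; elim/qpiW=> x.
have fq := ghom_comp fh ghom_qpi; have hq := ghom_comp hh ghom_qpi.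
exact: (sym_ext fq hq fhV x).
Qed.

Lemma fin_gen_symquot : fin_gen (symquot vG).
Proof.
apply: fin_gen_surj ghom_qpi _ (fin_gen_sym rG) => x.
by exists (qrepr x); apply: qreprK.
Qed.

Lemma symquot_s_projective :
  v != 0 -> in_Ts (symquot vG) -> s_projective (symquot vG).
Proof.
move=> v0 Ts; split=> // A A' q f ATs _ qh qs fh.
have fqh := ghom_comp fh ghom_qpi.
have [_ [f1 _] _ _] := fh.
pose phi u := f (@qpi k G (sym rG) r (symv u)).
have pl : linear_to phi := linear_to_comp fqh (linear_to_symv rG).
have pg : equivariant rG phi := equivariant_comp fqh (@equivariant_symv _ _ _ rG).
have [|Psi [Pl Pg qP Pv]] := equivariant_lift1 ATs qh qs pl pg v0 vG.
  by rewrite /phi qpi_symv.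
have [F [Fh FE]] := symquot_lift Pl Pg Pv.
exists F; split=> //.
by apply: (symquot_ext (ghom_comp qh Fh) fh) => u /=; rewrite FE; apply: qP.
Qed.

(** The two factors are lifted separately: B by its s-projectivity, S(V)/(v-1) by
    [equivariant_lift1], which uses only the element of trace 1 in the target A. *)
Lemma gtens_symquot_s_projective B :
  v != 0 -> s_projective B -> s_projective (gtens B (symquot vG)).
Proof.
move=> v0 [BTs Bp]; split; first exact: in_Ts_gtens fin_gen_symquot.
move=> A A' q f ATs A'Ts qh qs fh.
have [FB [FBh qFB]] :=
  Bp A A' q _ ATs A'Ts qh qs (ghom_comp fh (ghom_tinl B (symquot vG))).
have frh := ghom_comp fh (ghom_tinr B (symquot vG)).
have fqh := ghom_comp frh ghom_qpi.
pose phi u := f (tinr B (@qpi k G (sym rG) r (symv u) : symquot vG)).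
have pl : linear_to phi := linear_to_comp fqh (linear_to_symv rG).
have pg : equivariant rG phi := equivariant_comp fqh (@equivariant_symv _ _ _ rG).
have pv : phi v = 1 by rewrite /phi qpi_symv; case: frh => _ [].
have [Psi [Pl Pg qP Pv]] := equivariant_lift1 ATs qh qs pl pg v0 vG pv.
have [FC [FCh FCE]] := symquot_lift Pl Pg Pv.
have [F [Fh Fl Fr]] := gtens_lift FBh FCh.
exists F; split=> //; apply: (gtens_ext (ghom_comp qh Fh) fh) => [b|c] /=.
  by rewrite Fl qFB.
rewrite Fr; move: c; apply: (symquot_ext (ghom_comp qh FCh) frh) => u /=.
by rewrite FCE; apply: qP.
Qed.

Lemma gtens_sym_s_projective B :
  s_projective B -> s_projective (gtens B (sym rG)).
Proof.
move=> [BTs Bp]; split; first exact: in_Ts_gtens (fin_gen_sym rG).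
move=> A A' q f ATs A'Ts qh qs fh.
have [FB [FBh qFB]] :=
  Bp A A' q _ ATs A'Ts qh qs (ghom_comp fh (ghom_tinl B (sym rG))).
have frh := ghom_comp fh (ghom_tinr B (sym rG)).
pose phi u := f (tinr B (symv u : sym rG)).
have pl : linear_to phi := linear_to_comp frh (linear_to_symv rG).
have pg : equivariant rG phi := equivariant_comp frh (@equivariant_symv _ _ _ rG).
have [Psi [Pl Pg qP]] := equivariant_lift ATs qh qs pl pg.
have [FC [FCh FCE]] := sym_lift Pl.1 Pl.2 Pg.
have [F [Fh Fl Fr]] := gtens_lift FBh FCh.
exists F; split=> //; apply: (gtens_ext (ghom_comp qh Fh) fh) => [b|c] /=.
  by rewrite Fl qFB.
rewrite Fr; move: c; apply: (sym_ext (ghom_comp qh FCh) frh) => u /=.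
by rewrite FCE; apply: qP.
Qed.

Lemma tens_iso_symquot B : in_Ts B -> v != 0 -> tens_iso B (symquot vG) (symfact vG).
Proof.
move=> BTs v0; have [l l1] := gtr1_in_Ts BTs.
have [t [tl tv tg]] := linear_form B v0.
(* Averaging makes t equivariant and keeps its value at v, since v is fixed and t v = 1. *)
pose theta := average rG l t.
have thl : linear_to theta := linear_to_average rG l tl.
have thg : equivariant rG theta := @equivariant_average _ _ _ rG _ l t.
have thv : theta v = 1.
  rewrite /theta average_equivariant // => g.
  by rewrite (rfix_mxP _ vG) ?inE // tg.
pose Q := symquot vG; pose S := symfact vG.
pose rW := factmod_repr (fix_mxmodule vG).
pose U : 'M[k]_n := <<v>>%MS.
pose W := \rank (cokermx U).
have LBS := ghom_tinl B S; have RBS := ghom_tinr B S.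
have LBQ := ghom_tinl B Q; have RBQ := ghom_tinr B Q.
pose sW (w : 'rV[k]_W) : S := symv w.
pose sQ (u : 'rV[k]_n) : Q := @qpi k G (sym rG) r (symv u).
have sQl : linear_to sQ := linear_to_comp ghom_qpi (linear_to_symv rG).
have sQg : equivariant rG sQ := equivariant_comp ghom_qpi (@equivariant_symv _ _ _ rG).
pose prS (u : 'rV[k]_n) : S := sW (in_factmod U u).
have prl : linear_to prS.
  have [z Z] := linear_to_symv rW.
  by split=> [x y|c u]; rewrite /prS ?linearB ?linearZ; [apply: z|apply: Z].
have prg : equivariant rG prS.
  move=> u g; rewrite /prS (in_factmodJ (fix_mxmodule vG)) ?inE //.
  exact: (@equivariant_symv _ _ _ rW).
have prv : in_factmod U v = 0.
  by apply/eqP; rewrite in_factmod_eq0 genmxE.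
(* On V this is the isomorphism; it sends v to 1 because theta v = 1 and v dies in V/kv. *)
pose alpha u : gtens B S := tinl S (theta u) + tinr B (prS u).
have al : linear_to alpha.
  by apply: linear_toD; [apply: (linear_to_comp LBS)|apply: (linear_to_comp RBS)].
have ag : equivariant rG alpha.
  by apply: equivariantD; [apply: (equivariant_comp LBS)|apply: (equivariant_comp RBS)].
have [RS eRS] := ghom_rmorphism RBS; have [RQ eRQ] := ghom_rmorphism RBQ.
have av : alpha v = 1.
  rewrite /alpha thv /prS prv /sW raddf0 eRS rmorph0 addr0.
  by case: LBS => _ [].
pose beta0 u : gtens B Q := tinr B (sQ u) - tinl Q (theta u).
have b0l : linear_to beta0.
  apply: linear_toD; first exact: (linear_to_comp RBQ).
  exact: linear_toN (linear_to_comp LBQ thl).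
have b0g : equivariant rG beta0.
  apply: equivariantD; first exact: (equivariant_comp RBQ).
  exact: equivariantN (equivariant_comp LBQ thg).
have b0v : beta0 v = 0.
  rewrite /beta0 thv /sQ qpi_symv.
  by case: RBQ => _ [-> _] _ _; case: LBQ => _ [-> _] _ _; rewrite subrr.
have b0U u : (u <= U)%MS -> beta0 u = 0.
  rewrite genmxE => /sub_rVP[c ->].
  by case: b0l => _ ->; rewrite b0v mulr0.
(* As [beta0] vanishes on kv, the linear section [val_factmod] may be replaced by any other choice
   of representatives ([betaE]); this gives equivariance of [beta] although the section need not be
   equivariant. *)
pose beta (w : 'rV[k]_W) : gtens B Q := beta0 (val_factmod w).
have betaE u : beta (in_factmod U u) = beta0 u.
  apply/eqP; rewrite -subr_eq0 /beta; case: b0l => <- _.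
  apply/eqP/b0U; rewrite -in_factmod_eq0 linearB /= val_factmodK subrr //.
have bl : linear_to beta.
  have [z Z] := b0l.
  by split=> [x y|c u]; rewrite /beta ?linearB ?linearZ; [apply: z|apply: Z].
have bg : equivariant rW beta.
  move=> w g; rewrite -{1}[w]val_factmodK -(in_factmodJ (fix_mxmodule vG)) ?inE // betaE b0g.
  by rewrite /beta.
have [FQ [FQh FQE]] := symquot_lift al ag av.
have [FS [FSh FSE]] := sym_lift bl.1 bl.2 bg.
have [f [fh fl fr]] := gtens_lift LBS FQh.
have [h [hh hl hr]] := gtens_lift LBQ FSh.
have [f' ef] := ghom_rmorphism fh; have [h' eh] := ghom_rmorphism hh.
have hf : cancel f h.
  apply: (gtens_ext (ghom_comp hh fh) (ghom_id _)) => [b|c] /=; first by rewrite fl hl.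
  rewrite fr; move: c; apply: (symquot_ext (ghom_comp hh FQh) RBQ) => u /=.
  rewrite FQE /alpha eh rmorphD -eh hl hr FSE betaE /beta0.
  by rewrite addrC subrK.
have fhK : cancel h f.
  apply: (gtens_ext (ghom_comp fh hh) (ghom_id _)) => [b|c] /=; first by rewrite hl fl.
  rewrite hr; move: c; apply: (sym_ext (ghom_comp fh FSh) RBS) => w /=.
  rewrite FSE /beta /beta0 ef rmorphB -ef fl fr FQE /alpha.
  by rewrite addrC addKr /prS val_factmodK.
by exists f; split=> //; exists h.
Qed.

End SymmetricQuotient.

(* For v = 0 the algebra S(V)/(v-1) is zero and all three claims about it     *)
(* fail, hence the hypothesis v != 0.                                         *)
Theorem theorem4p9 (k : fieldType) (p : nat) (charkp : p \in [pchar k])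
    (G : finGroupType) (H : {group G})
    (sylH : (p.-Sylow([set: G]) H)%g) (ntH : (H :!=: 1)%g)
    (n : nat) (rG : mx_representation k [set: G] n) :
  [/\ forall (v : 'rV[k]_n) (vG : (v <= rfix_mx rG [set: G])%MS)
          (f : sym rG) (N : nat),
        v != 0 ->
        (symv v : sym rG) ^+ (p ^ N) = gtr [set: G] f \/
        (symv v : sym rG) ^+ (p ^ N) = gtr H f ->
        in_Ts (symquot vG) /\ s_projective (symquot vG),
      forall (B : galgebra k G) (v : 'rV[k]_n)
          (vG : (v <= rfix_mx rG [set: G])%MS),
        in_Ts B -> v != 0 -> tens_iso B (symquot vG) (symfact vG)
    & forall B : galgebra k G,
        in_Ts B -> s_projective B ->
        s_projective (gtens B (sym rG)) /\
        forall (v : 'rV[k]_n) (vG : (v <= rfix_mx rG [set: G])%MS),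
          v != 0 -> s_projective (gtens B (symquot vG))].
Proof.
split=> [v vG f N v0 vf|B v vG BTs v0|B _ Bp].
- have Ts : in_Ts (symquot vG).
    apply: in_Ts_gtr1; first exact: fin_gen_symquot.
    have qh := ghom_qpi vG; have [q eq] := ghom_rmorphism qh.
    (* Modulo v - 1 the power of v becomes 1, so the class of f has trace 1 over K. *)
    have gtr1 K : (symv v : sym rG) ^+ (p ^ N) = gtr K f ->
        exists a : symquot vG, gtr K a = 1.
      move=> e; exists (@qpi k G (sym rG) (symv v - 1) f).
      by rewrite -(ghom_gtr _ _ qh) -e eq rmorphXn -eq /= qpi_symv expr1n.
    case: vf => /gtr1 // [a a1]; exact: gtr_Sylow charkp sylH a1.
  by split=> //; apply: symquot_s_projective.
- exact: tens_iso_symquot.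
- split; first exact: gtens_sym_s_projective.
  by move=> v vG v0; apply: gtens_symquot_s_projective.
Qed.
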